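(* Let $(X,d)$ be a metric space with $|X|\geqslant 3$, let $k\in\mathbb{N}$ with $3\leqslant k\leqslant|X|$, and let $T\colon X\to X$ be a perimetric contraction on $k$-polygons in $X$ with coefficient $\lambda$ satisfying $0\leqslant\lambda<\frac{1}{k+1}$. Then $T$ is a Kannan-type perimetric contraction on $k$-polygons in $X$ (with respect to the same metric $d$).
   Context: $|X|$ denotes the cardinality of $X$ (possibly infinite). For points $x_1,\ldots,x_k$ of a metric space $(X,d)$, $k\geqslant 3$, put $P(x_1,x_2,\ldots,x_k)=d(x_1,x_2)+d(x_2,x_3)+\cdots+d(x_{k-1},x_k)+d(x_k,x_1)$. For $3\leqslant k\leqslant |X|$, a map $T\colon X\to X$ is a perimetric contraction on $k$-polygons (also called a mapping contracting perimeters of $k$-polygons) with coefficient $\lambda\in[0,1)$ if $P(Tx_1,\ldots,Tx_k)\leqslant\lambda P(x_1,\ldots,x_k)$ for all $k$ pairwise distinct points $x_1,\ldots,x_k\in X$. A map $T\colon X\to X$ is a Kannan-type perimetric contraction on $k$-polygons in $X$ if there exists $\mu\in[0,\frac{2}{k})$ such that $P(Tx_1,\ldots,Tx_k)\leqslant\mu\big(d(x_1,Tx_1)+d(x_2,Tx_2)+\cdots+d(x_k,Tx_k)\big)$ for all $k$ pairwise distinct points $x_1,\ldots,x_k\in X$. *)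

(* Defs.v *)
From HB Require Import structures.
From mathcomp Require Import all_boot all_order all_algebra.
From mathcomp Require Import all_classical all_reals all_analysis.

Set Implicit Arguments.
Unset Strict Implicit.
Unset Printing Implicit Defensive.

Import Order.TTheory GRing.Theory Num.Theory.
Local Open Scope ring_scope.

(* The points x_1, ..., x_k are indexed from 0; ordS is the successor modulo k,
   so the last term is the closing edge mdist x_k x_1. *)
Definition perimeter (R : realType) (X : metricType R) (k : nat)
    (x : 'I_k -> X) : R :=
  \sum_(i < k) mdist (x i) (x (ordS i)).

Definition perimetric_contraction (R : realType) (X : metricType R) (k : nat)
    (T : X -> X) (lambda : R) : Prop :=
  0 <= lambda < 1 /\
  forall x : 'I_k -> X, injective x ->
    perimeter (fun i => T (x i)) <= lambda * perimeter x.

Definition kannan_perimetric_contraction (R : realType) (X : metricType R)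
    (k : nat) (T : X -> X) : Prop :=
  exists mu : R, 0 <= mu < 2 / k%:R /\
  forall x : 'I_k -> X, injective x ->
    perimeter (fun i => T (x i)) <= mu * \sum_(i < k) mdist (x i) (T (x i)).

(* Main.v *)
(** Detouring each edge [x_i x_(i+1)] through [T x_i] and [T x_(i+1)] gives
    [P(x) <= P(Tx) + 2 S] with [S] the sum of the displacements [d(x_i, T x_i)].
    Combined with [P(Tx) <= lambda P(x)] this yields
    [P(Tx) <= 2 lambda / (1 - lambda) S], and [2 lambda / (1 - lambda) < 2 / k]
    is equivalent to [lambda < 1 / (k + 1)]. *)
Require Import Defs.
From mathcomp Require Import all_boot all_order all_algebra.
From mathcomp Require Import all_classical all_reals all_analysis.
From mathcomp Require Import ring lra.

Import Order.TTheory GRing.Theory Num.Theory.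

Local Open Scope classical_set_scope.
Local Open Scope card_scope.
Local Open Scope ring_scope.

Lemma perimeter_le_displacement (R : realType) (X : metricType R) (k : nat)
    (x y : 'I_k -> X) :
  perimeter x <= perimeter y + 2 * \sum_(i < k) mdist (x i) (y i).
Proof.
(* Each vertex ends two edges, hence the factor 2: as [ordS] permutes the indices, the far ends
   contribute the same sum as the near ends. *)
have sumS : \sum_(i < k) mdist (x (ordS i)) (y (ordS i)) =
    \sum_(i < k) mdist (x i) (y i).
  by rewrite [RHS](reindex_inj (@ordS_inj k)).
rewrite (_ : 2 * _ = \sum_(i < k) mdist (x i) (y i) +
    \sum_(i < k) mdist (x (ordS i)) (y (ordS i))); last by rewrite sumS; ring.
rewrite -!big_split; apply: ler_sum => i _ /=.
have := metric_triangle (x i) (y i) (x (ordS i)).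
have := metric_triangle (y i) (y (ordS i)) (x (ordS i)).
rewrite (metric_sym (y (ordS i)) (x (ordS i))); lra.
Qed.

Theorem proposition3p6 (R : realType) (X : metricType R)
    (X_ge3 : `I_3 #<= [set: X])
    (k : nat) (k_ge3 : (3 <= k)%N) (k_leX : `I_k #<= [set: X])
    (T : X -> X) (lambda : R)
    (T_contr : perimetric_contraction k T lambda)
    (lambda_ge0 : 0 <= lambda) (lambda_lt : lambda < 1 / (k%:R + 1)) :
  kannan_perimetric_contraction k T.
Proof.
have [/andP[_ lambda_lt1] contr] := T_contr.
have k_gt0 : 0 < k%:R :> R by rewrite ltr0n (leq_trans _ k_ge3).
have den_gt0 : 0 < 1 - lambda by rewrite subr_gt0.
exists (2 * lambda / (1 - lambda)); split.
  apply/andP; split; first by rewrite divr_ge0 ?mulr_ge0 // ltW.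
  (* Clearing denominators leaves [2 * lambda * k < 2 * (1 - lambda)], linear in [lambda * k]. *)
  rewrite ltr_pdivrMr // mulrAC ltr_pdivlMr //.
  move: lambda_lt; rewrite ltr_pdivlMr; last lra.
  lra.
move=> x /contr Px; rewrite mulrAC ler_pdivlMr //.
(* With [Px] this gives P(Tx) <= lambda P(Tx) + 2 lambda S; the first term on the right moves to the
   left. *)
have := ler_wpM2l lambda_ge0 (perimeter_le_displacement _ _ _ x (fun i => T (x i))).
lra.
Qed.
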